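(* For each $k\in\{1,2,3\}$, the sequence $(x_{3n+k},y_{3n+k})_{n\ge 0}$ does not have three consecutive terms in $\mathcal{S}\setminus\mathcal{C}$. In particular, the set $\mathcal{C}$ is infinite.
   Context: For a positive real number $z$, $\delta(z)=\lfloor\log_{10} z\rfloor$. $\mathcal{S}=\{(x,y)\in\mathbb{Z}^2 : x>y\ge 1,\ x(x+1)=10\,y(y+1)\}$, regarded as the sequence $(x_n,y_n)_{n\ge1}$ given by $(x_1,y_1)=(4,1)$, $(x_2,y_2)=(20,6)$, $(x_3,y_3)=(39,12)$ and, for $n\ge 1$, $x_{n+3}=19x_n+60y_n+39$, $y_{n+3}=6x_n+19y_n+12$. Finally, $\mathcal{C}=\{(x,y)\in\mathcal{S} : \delta(x+1)=\delta(y+1)+1\}$. *)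

(* Defs.v *)
From mathcomp Require Import all_boot all_order all_algebra.
From mathcomp Require Import all_classical all_reals all_analysis.

Set Implicit Arguments.
Unset Strict Implicit.
Unset Printing Implicit Defensive.

Import Order.TTheory GRing.Theory Num.Theory.
Local Open Scope classical_set_scope.
Local Open Scope ring_scope.

(* Meaningful only for 0 < z, where ln z / ln 10 is the decimal logarithm;
   ln is a total function with ln z = 0 for z <= 0. *)
Definition delta (R : realType) (z : R) : int := Num.floor (ln z / ln 10).

Definition calS : set (int * int) :=
  [set p | [/\ p.1 > p.2, p.2 >= 1
             & p.1 * (p.1 + 1) = 10 * p.2 * (p.2 + 1)]].

(* The pair (x_n, y_n), indexed from n = 1; the value at n = 0 is a dummy. *)
Fixpoint xy (n : nat) : int * int :=
  match n with
  | 0 => (0, 0)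
  | 1 => (4, 1)
  | 2 => (20, 6)
  | 3 => (39, 12)
  | (_.+1 as m).+3 => (19 * (xy m).1 + 60 * (xy m).2 + 39,
                       6 * (xy m).1 + 19 * (xy m).2 + 12)
  end.

Definition calC (R : realType) : set (int * int) :=
  [set p | calS p /\
     delta ((p.1 + 1)%:~R : R) = delta ((p.2 + 1)%:~R : R) + 1].

(* Main.v *)
Require Import Defs.
From mathcomp Require Import all_boot all_order all_algebra.
From mathcomp Require Import all_classical all_reals all_analysis.
From mathcomp Require Import zify.

Set Implicit Arguments.
Unset Strict Implicit.
Unset Printing Implicit Defensive.

Import Order.TTheory GRing.Theory Num.Theory.
Local Open Scope classical_set_scope.
Local Open Scope ring_scope.

(* A pair (x, y) of S lies outside C exactly when x + 1 and y + 1 lie in the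
   same decade [10^d, 10^(d+1)). As x is about sqrt 10 * y, one step of the
   recurrence multiplies y + 1 by about 37.97, i.e. shifts log10 (y + 1) by
   about 0.58 modulo 1, while lying outside C means that its fractional part is
   below about 1/2. Two consecutive terms outside C hence force the second
   fractional part into [0, 0.1), and the third one is then near 0.6, so that the
   third term is in C. *)

Definition step (p : int * int) : int * int :=
  (19 * p.1 + 60 * p.2 + 39, 6 * p.1 + 19 * p.2 + 12).

Lemma xy_step (m : nat) : (0 < m)%N -> xy m.+3 = step (xy m).
Proof. by case: m. Qed.

Lemma xy_mul3S (n k : nat) : (0 < k)%N ->
  xy (3 * n.+1 + k)%N = step (xy (3 * n + k)%N).
Proof.
move=> k0; rewrite -xy_step ?ltn_addl //; congr xy; lia.
Qed.

Lemma calS_step p : calS p -> calS (step p).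
Proof. by case: p => x y [] /= *; split => /=; nia. Qed.

(** The ratio [sqrt 10] enters only through the integer 3: [x <= 3 * y] would give
    [x * (x + 1) < 10 * y * (y + 1)]. *)
Lemma calS_lower p : calS p -> 3 * p.2 + 1 <= p.1.
Proof. by case: p => x y [] /= *; nia. Qed.

Lemma calS_upper p : calS p -> p.1 <= 10 * p.2.
Proof. by case: p => x y [] /= *; nia. Qed.

Lemma delta_decade (R : realType) (d : nat) (z : R) :
  10 ^+ d <= z -> z < 10 ^+ d.+1 -> delta z = d%:Z.
Proof.
move=> lez ltz; have z0 : 0 < z by apply: lt_le_trans lez; rewrite exprn_gt0.
have ln10 : 0 < ln (10 : R) by rewrite ln_gt0 // ltr1n.
apply/eqP; rewrite /delta floor_eq ler_pdivlMr // ltr_pdivrMr //.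
rewrite -[(d%:Z + 1)%:~R]/((d + 1)%:R) addn1 !mulr_natl -!lnXn ?ltr0n //.
by rewrite ler_ln ?ltr_ln ?posrE ?exprn_gt0 // lez ltz.
Qed.

Lemma delta_decade_int (R : realType) (d : nat) (z : int) :
  10 ^+ d <= z -> z < 10 ^+ d.+1 -> delta (z%:~R : R) = d%:Z.
Proof.
move=> lez ltz; apply: delta_decade.
  by rewrite -[10]/(10%:~R) -rmorphXn ler_int.
by rewrite -[10]/(10%:~R) -rmorphXn ltr_int.
Qed.

Lemma int_decade (z : int) : 0 < z ->
  exists d : nat, 10 ^+ d <= z /\ z < 10 ^+ d.+1.
Proof.
case: z => // n n0; exists (trunc_log 10 n).
have /andP[] : (10 ^ trunc_log 10 n <= n < 10 ^ (trunc_log 10 n).+1)%N.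
  exact: trunc_log_bounds.
by rewrite -!natrX !natz lez_nat ltz_nat.
Qed.

(** Since [x <= 10 * y], [x + 1] lies at most one decade above [y + 1]; reaching the next decade
    would put the pair in C. *)
Lemma notin_calC_decade (R : realType) p : (calS `\` calC R) p ->
  exists d : nat, 10 ^+ d <= p.2 + 1 /\ p.1 + 1 < 10 ^+ d.+1.
Proof.
case: p => x y [Sp nCp]; have := calS_upper Sp; case: (Sp) => /= ltyx y1 _ lex.
have [|d [led ltd]] := @int_decade (y + 1); first by lia.
exists d; split=> //; rewrite ltNge; apply/negP => lex1; apply: nCp; split=> //=.
rewrite (delta_decade_int R led ltd) (@delta_decade_int _ d.+1) //; first by lia.
by rewrite exprS; lia.
Qed.

(** Keeps the discreteness of the powers of 10 once they are generalized to plain integers for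
    [lia]. *)
Lemma exp10_lt (e d : nat) :
  (10 : int) ^+ e < 10 * 10 ^+ d -> (10 : int) ^+ e <= 10 ^+ d.
Proof. by rewrite -exprS ltr_eXn2l // ler_eXn2l. Qed.

Lemma exp10_1or10 (d : nat) : (10 : int) ^+ d = 1 \/ 10 <= (10 : int) ^+ d.
Proof.
case: d => [|d]; [by left | right].
by rewrite exprS ler_peMr // exprn_ege1.
Qed.

Lemma three_consecutive (R : realType) p :
  ~ [/\ (calS `\` calC R) p, (calS `\` calC R) (step p)
      & (calS `\` calC R) (step (step p))].
Proof.
move=> [Cp Cp' Cp''].
have lex := calS_lower Cp.1; have lex' := calS_lower Cp'.1.
have := Cp.1; case=> _ y1 _.
have [d [led ltd]] := notin_calC_decade Cp.
have [d' [led' ltd']] := notin_calC_decade Cp'.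
have [d'' [led'' ltd'']] := notin_calC_decade Cp''.
case: p y1 lex lex' led ltd led' ltd' led'' ltd'' {Cp Cp' Cp''} => x y /=.
(* The first two facts force [D' = 100 * D], the third [D'' <= 1000 * D]. Splitting off [D = 1]
   handles the additive constants: there [y >= 1] yields [100 * D < x' + 1], while for [D >= 10] the
   bound [x' + 1 >= 117 * D - 58] suffices. *)
have De0 := @exp10_lt d' d.+2; have De1 := @exp10_lt d.+2 d'.
have De2 := @exp10_lt d'' d'.+1; have D10 := exp10_1or10 d.
move: De0 De1 De2 D10; rewrite !exprS.
move: (10 ^+ d : int) (10 ^+ d' : int) (10 ^+ d'' : int) => D D' D''.
(* The clash: [x'' + 1 >= 117 * y' + 59 >= 11700 * D - 58] exceeds [10 * D'']. *)
lia.
Qed.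

Lemma calS_xy (n : nat) : calS (xy (3 * n + 1)%N).
Proof.
elim: n => [|n IHn]; first by split.
by rewrite xy_mul3S //; apply: calS_step.
Qed.

Lemma xy_ge (n : nat) : n%:Z <= (xy (3 * n + 1)%N).2.
Proof.
elim: n => // n IHn; rewrite xy_mul3S //=.
by have [/=] := calS_xy n; lia.
Qed.

Lemma finite_calC_bounded (A : set (int * int)) : finite_set A ->
  exists N : nat, forall p, A p -> p.2 <= N%:Z.
Proof.
move=> /finite_seqP[s ->]; exists (\max_(p <- s) `|p.2|)%N => p /= sp.
apply: le_trans (lez_abs _) _; rewrite lez_nat.
exact: (@leq_bigmax_seq _ s xpredT (fun p : int * int => `|p.2|%N)).
Qed.

Theorem proposition6 (R : realType) :
  (forall k : nat, (1 <= k <= 3)%N ->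
     ~ exists n : nat,
         [/\ (calS `\` calC R) (xy (3 * n + k)%N),
             (calS `\` calC R) (xy (3 * n.+1 + k)%N)
           & (calS `\` calC R) (xy (3 * n.+2 + k)%N)]) /\
  infinite_set (calC R).
Proof.
split=> [k /andP[k0 _] [n]|/finite_calC_bounded[N leN]].
  by rewrite !xy_mul3S //; apply: three_consecutive.
(* If C were finite, the terms with [k = 1] would eventually outgrow the bound on [y] and all leave
   C. *)
have out n : (N < n)%N -> (calS `\` calC R) (xy (3 * n + 1)%N).
  move=> ltNn; split; first exact: calS_xy.
  by move=> /leN; have := xy_ge n; lia.
apply: (@three_consecutive R (xy (3 * N.+1 + 1)%N)).
by rewrite -!xy_mul3S //; split; apply: out; lia.
Qed.
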